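(* Let $k\ge 2$ be an integer. Let $\theta_1,\ldots,\theta_{k-1}$ be irrational real numbers and assume that for some real numbers $0<\gamma_1<\gamma_2$ the system $$\gamma_1 q^{-(k-1)} < \max_{1\le j\le k-1} \Vert q\theta_j\Vert < \gamma_2 q^{-(k-1)}$$ has infinitely many solutions in integers $q$. Then the set $$\left\{ (\xi,\zeta_1,\ldots,\zeta_{k-1})\in\mathbb{R}^k:\;\limsup_{Q\to\infty}\, Q \min_{q\in \mathbb{Z},\,0<q\le Q} \Vert q\xi\Vert \cdot \prod_{j=1}^{k-1} \Vert q\zeta_j-\theta_j\Vert > 0 \right\}$$ contains a dense $G_{\delta}$ subset of $\mathbb{R}^k$.
   Context: $\Vert x\Vert$ denotes the distance from the real number $x$ to the nearest integer. In $\limsup_{Q\to\infty}$ the variable $Q$ runs through the positive integers; the upper limit is taken in $[0,\infty]$. *)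

(* Defs.v *)
From HB Require Import structures.
From mathcomp Require Import all_boot all_order all_algebra.
From mathcomp Require Import all_classical all_reals all_analysis.

Set Implicit Arguments.
Unset Strict Implicit.
Unset Printing Implicit Defensive.

Import Order.TTheory GRing.Theory Num.Theory.
Import numFieldNormedType.Exports.

Local Open Scope classical_set_scope.
Local Open Scope ring_scope.

Definition dist_int (R : realType) (x : R) : R :=
  inf [set `|x - n%:~R| | n in [set: int]].

(* A point of R^k is a row vector x = (xi, zeta_1, ..., zeta_{k-1}): xi is its
   coordinate of index i0 and zeta_j is its coordinate of index lift i0 j,
   which is the index j + 1 when i0 is the first index. *)
Definition inhom_product (R : realType) (k : nat) (i0 : 'I_k)
    (theta : 'I_k.-1 -> R) (x : 'rV[R]_k) (q : int) : R :=
  dist_int (q%:~R * x ord0 i0) *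
  \prod_(j < k.-1) dist_int (q%:~R * x ord0 (lift i0 j) - theta j).

(* The minimum is taken in the extended reals, where +oo is neutral for it;
   for Q >= 1 its range is nonempty, so it is the minimum of real numbers. *)
Definition scaled_min (R : realType) (k : nat) (i0 : 'I_k)
    (theta : 'I_k.-1 -> R) (x : 'rV[R]_k) (Q : nat) : \bar R :=
  (Q%:R%:E *
   \big[mine/+oo]_(1 <= q < Q.+1) (inhom_product i0 theta x q%:Z)%:E)%E.

(* Main.v *)
Require Import Defs.
From HB Require Import structures.
From mathcomp Require Import all_boot all_order all_algebra.
From mathcomp Require Import all_classical all_reals all_analysis.
From mathcomp Require Import borel_hierarchy.
From mathcomp Require Import ring lra zify.

(**
The set in the theorem contains an intersection of countably many open sets
F_M, where x lies in F_M when T * inhom_product x q > c/2 for all 0 < q <= T,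
for some T > M.  The constant c > 0 depends only on theta, so by Baire's
theorem it is enough that every F_M is dense: near every point there has to be
a point x with T * inhom_product x q >= c for all 0 < q <= T, T arbitrarily
large.

Such points are rational up to a tiny shift of the first coordinate.  Take
powers of two N_j with N_j | N_0 and put
  T = N_0 * prod_j N_j,  zeta_j = b_j / N_j,  xi = a / N_0 + eta,  a odd,
with eta = 1 / (2 N_0 T).  For 0 < q <= T there are two cases.

- If N_0 does not divide q, then q a / N_0 is at distance at least 1 / N_0 from
  the integers, and q eta <= 1 / (2 N_0), so ||q xi|| >= 1 / (2 N_0).  Also
  N_j ||q zeta_j - theta_j|| >= ||N_j theta_j||, because N_j q zeta_j is an
  integer.  If the N_j satisfy ||N_j theta_j|| >= 1/4, the product of all the
  factors is at least a constant over N_0 * prod_j N_j = T.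
- If N_0 divides q, then every q zeta_j is an integer, so
  ||q zeta_j - theta_j|| = ||theta_j||, which is positive by irrationality,
  while ||q xi|| = q eta >= N_0 eta = 1 / (2 T).

Both cases are in [product_lower_bound].  The condition ||2^s theta_j|| >= 1/4
holds for arbitrarily large s, because doubling a real number doubles its
distance to the integers as long as this distance is below 1/4
([dist_int_pow2_large]).  Powers of two serve a second purpose: the numerators
a prime to N_0 are the odd integers, so the fractions a / N_0 come within
1 / N_0 of every real number ([exists_near_point_large_product]).
*)

Set Implicit Arguments.
Unset Strict Implicit.
Unset Printing Implicit Defensive.

Import Order.TTheory GRing.Theory Num.Theory.
Import numFieldNormedType.Exports.

Local Open Scope classical_set_scope.
Local Open Scope ring_scope.

(** * Distance to the nearest integer *)

Section DistanceToNearestInteger.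
Variable R : realType.
Implicit Types (x y : R) (n : int).

Lemma dist_int_le x n : dist_int x <= `|x - n%:~R|.
Proof.
apply: ge_inf; last by exists n.
by exists 0 => _ [m _ <-].
Qed.

Lemma le_dist_int c x : (forall n, c <= `|x - n%:~R|) -> c <= dist_int x.
Proof.
move=> h; apply: lb_le_inf; first by exists `|x - 0%:~R|, 0.
by move=> _ [n _ <-].
Qed.

Lemma dist_int_ge0 x : 0 <= dist_int x.
Proof. by apply: le_dist_int. Qed.

Lemma dist_int_le1 x : dist_int x <= 1.
Proof.
apply: le_trans (dist_int_le x (Num.floor x)) _.
have /andP[h1 h2] := floor_itv x.
by rewrite intrD in h2; rewrite ler_norml; apply/andP; split; lra.
Qed.

Lemma dist_int_lipschitz x y : dist_int x <= dist_int y + `|x - y|.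
Proof.
rewrite -lerBlDr; apply: le_dist_int => n.
rewrite lerBlDr; apply: le_trans (dist_int_le x n) _.
have -> : x - n%:~R = (y - n%:~R) + (x - y) by ring.
exact: ler_normD.
Qed.

Lemma dist_intDz x n : dist_int (x + n%:~R) = dist_int x.
Proof.
apply/eqP; rewrite eq_le; apply/andP; split; apply: le_dist_int => m.
  have := dist_int_le (x + n%:~R) (m + n).
  have -> : x + n%:~R - (m + n)%:~R = x - m%:~R by rewrite intrD; ring.
  by [].
have := dist_int_le x (m - n).
by rewrite intrB opprB addrA.
Qed.

Lemma dist_intN x : dist_int (- x) = dist_int x.
Proof.
suff h : forall y, dist_int y <= dist_int (- y).
  by apply/eqP; rewrite eq_le h andbT; have := h (- x); rewrite opprK.
move=> y; apply: le_dist_int => n; have := dist_int_le y (- n).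
by rewrite -[`|- y - _|]normrN opprD !opprK intrN opprK.
Qed.

Lemma dist_intMn (m : nat) x : dist_int (m%:R * x) <= m%:R * dist_int x.
Proof.
have [->|m0] := posnP m.
  by rewrite !mul0r; have := dist_int_le 0 0; rewrite subrr normr0.
have mR : (0 : R) < m%:R by rewrite ltr0n.
rewrite -ler_pdivrMl//; apply: le_dist_int => n.
rewrite ler_pdivrMl//; apply: le_trans (dist_int_le _ (m%:Z * n)) _.
by rewrite intrM -mulrBr normrM ger0_norm// ltW.
Qed.

Lemma dist_int_id x : 0 <= x <= 2^-1 -> x <= dist_int x.
Proof.
move=> /andP[x0 x1]; apply: le_dist_int => n.
have [n0|n0] := lerP n 0.
  apply: le_trans (ler_norm _); rewrite lerBrDl gerDr.
  by rewrite lerz0.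
have : (1 : R) <= n%:~R by rewrite ler1z.
move=> h; rewrite distrC; apply: le_trans (ler_norm _); lra.
Qed.

Lemma dist_int_gt0 x : irrational x -> 0 < dist_int x.
Proof.
move=> irx; have /andP[h1 h2] := floor_itv x.
set f := Num.floor x in h1 h2; rewrite intrD in h2.
have h3 : f%:~R < x.
  rewrite lt_neqAle h1 andbT; apply/eqP => fx; apply: irx.
  by exists (f%:~R) => //=; rewrite ratr_int.
apply: (@lt_le_trans _ _ (Num.min (x - f%:~R) (f%:~R + 1 - x))).
  by rewrite lt_min; apply/andP; split; lra.
apply: le_dist_int => n; have [nf|nf] := lerP n f.
  have : (n%:~R : R) <= f%:~R by rewrite ler_int.
  by move=> ?; rewrite ge_min; apply/orP; left; apply: le_trans (ler_norm _); lra.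
have : (f%:~R + 1 : R) <= n%:~R by rewrite -[1]/(1%:~R) -intrD ler_int; lia.
move=> ?; rewrite ge_min; apply/orP; right.
by rewrite distrC; apply: le_trans (ler_norm _); lra.
Qed.

(** If n is within 1/4 of x, then 2n is the integer nearest to 2x: any other
    integer is at distance at least 1 - 2 |x - n| > 1/2 from 2x. *)
Lemma dist_int_double x : dist_int x < 4^-1 -> 2 * dist_int x <= dist_int (2 * x).
Proof.
move=> h; have [n hn] : exists n, `|x - n%:~R| < 4^-1.
  apply: contrapT => /forallNP h'; move: h; apply/negP; rewrite -leNgt.
  by apply: le_dist_int => n; rewrite leNgt; apply/negP/h'.
have hd := dist_int_le x n.
apply: le_dist_int => m; have [->|mn] := eqVneq m (2 * n).
  by rewrite intrM -mulrBr normrM ger0_norm// ler_pM2l.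
have : (1 : R) <= `|(2 * n)%:~R - m%:~R|.
  by rewrite -intrB -intr_norm ler1z; lia.
rewrite intrM => h1.
have := ler_normB (2 * x - m%:~R) (2 * (x - n%:~R)).
rewrite normrM ger0_norm//.
have -> : 2 * x - m%:~R - 2 * (x - n%:~R) = 2 * n%:~R - m%:~R by ring.
by move=> h2; lra.
Qed.

(** Otherwise, from the exponent S on, each doubling would double the distance
    to the integers, which is positive at the start and would remain below
    1/4. *)
Lemma dist_int_pow2_large x (S : nat) : irrational x ->
  exists2 s, (S <= s)%N & 4^-1 <= dist_int ((2 ^ s)%:R * x).
Proof.
move=> irx; apply: contrapT => hn.
have h s : (S <= s)%N -> dist_int ((2 ^ s)%:R * x) < 4^-1.
  by move=> Ss; rewrite ltNge; apply/negP => h; apply: hn; exists s.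
have d1 : 0 < dist_int ((2 ^ S)%:R * x).
  apply: dist_int_gt0 => -[r _ rx]; apply: irx.
  exists (r / (2 ^ S)%:R) => //.
  have N0 : (2 ^ S)%:R != 0 :> R by rewrite pnatr_eq0 expn_eq0.
  by rewrite fmorph_div/= rx ratr_nat mulrAC divff// mul1r.
have grow t : (2 ^ t)%:R * dist_int ((2 ^ S)%:R * x) <=
    dist_int ((2 ^ (S + t))%:R * x).
  elim: t => [|t IH]; first by rewrite addn0 mul1r.
  rewrite addnS !expnS !natrM -!mulrA.
  apply: le_trans (dist_int_double (h _ (leq_addr _ _))).
  by rewrite ler_pM2l.
set d := dist_int _ in d1 grow.
have := archi_boundP (ltW (divr_gt0 ltr01 d1)).
set t := Num.Def.archi_bound _ => ht.
have h1 : d^-1 < (2 ^ t)%:R.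
  by rewrite -div1r; apply: lt_trans ht _; rewrite ltr_nat ltn_expl.
rewrite -div1r ltr_pdivrMr// in h1.
have := h _ (leq_addr t S); have := grow t; lra.
Qed.

(** * Lower bound at shifted rational points *)

Lemma dist_int_frac_ge (N0 q : nat) (a : int) : (0 < N0)%N ->
  coprimez N0 a -> ~~ (N0 %| q)%N ->
  N0%:R^-1 <= dist_int (q%:R * (a%:~R / N0%:R) : R).
Proof.
move=> N0_gt0 co ndvd; have NR : (0 : R) < N0%:R by rewrite ltr0n.
apply: le_dist_int => n.
rewrite -(ler_pM2l NR) divff ?gt_eqF// -[X in X * `|_|](ger0_norm (ltW NR)).
rewrite -normrM.
have -> : N0%:R * (q%:R * (a%:~R / N0%:R) - n%:~R) =
    (q%:Z * a - n * N0%:Z)%:~R :> R.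
  by rewrite intrB !intrM -!pmulrn; field; rewrite gt_eqF.
rewrite -intr_norm ler1z -gtz0_ge1 normr_gt0 subr_eq0.
apply: contra ndvd => /eqP e.
have : (N0%:Z %| q%:Z * a)%Z by rewrite e dvdz_mull.
by rewrite Gauss_dvdzl.
Qed.

(** The shift (2 N0 T)^-1 is the size that balances the two cases: multiplied by
    q <= T it costs at most half of the distance 1 / N0 available when N0 does not
    divide q, and when N0 divides q it still gives a distance of order 1 / T.
    The factors dist_int (theta j) / 4 of the constant are at most
    dist_int (theta j) and at most 1/4, the values that the two cases provide. *)
Lemma product_lower_bound (m : nat) (theta : 'I_m -> R) (N0 : nat)
    (N : 'I_m -> nat) (a : int) (b : 'I_m -> int)
    (T := (N0 * \prod_j N j)%N) (q : nat) :
  (0 < N0)%N -> (forall j, N j %| N0)%N -> coprimez N0 a ->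
  (forall j, 4^-1 <= dist_int ((N j)%:R * theta j)) ->
  (0 < q <= T)%N ->
  2^-1 * \prod_j (dist_int (theta j) / 4) <=
  T%:R * (dist_int (q%:R * (a%:~R / N0%:R + (2 * N0%:R * T%:R)^-1)) *
          \prod_j dist_int (q%:R * ((b j)%:~R / (N j)%:R) - theta j)).
Proof.
move=> N0_gt0 NN0 co hN /andP[q0 qT].
have Nj_gt0 j : (0 < N j)%N by apply: dvdn_gt0 (NN0 j).
have T_gt0 : (0 < T)%N by apply: leq_trans qT.
have NR : (0 : R) < N0%:R by rewrite ltr0n.
have NjR j : (0 : R) < (N j)%:R by rewrite ltr0n.
have TR : (0 : R) < T%:R by rewrite ltr0n.
have qTR : (q%:R : R) <= T%:R by rewrite ler_nat.
set eta := (2 * N0%:R * T%:R)^-1.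
have eta0 : 0 < eta by rewrite invr_gt0 !mulr_gt0.
have Teta : T%:R * eta = (2 * N0%:R)^-1.
  by rewrite /eta; field; rewrite !gt_eqF.
have qeta : q%:R * eta <= (2 * N0%:R)^-1 by rewrite -Teta ler_pM2r.
set c := \prod_j _; have c_ge0 : 0 <= c.
  by apply: prodr_ge0 => j _; rewrite divr_ge0// dist_int_ge0.
have [dq|ndq] := boolP (N0 %| q)%N.
- (* q a / N0 is an integer: only the shift contributes to the first factor. *)
  have [l ql] := dvdnP dq.
  have -> : q%:R * (a%:~R / N0%:R + eta) = q%:R * eta + (l%:Z * a)%:~R.
    rewrite mulrDr addrC; congr (_ + _).
    by rewrite ql intrM -pmulrn natrM; field; rewrite gt_eqF.
  rewrite dist_intDz.
  have h1 : (2 * T%:R)^-1 <= dist_int (q%:R * eta).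
    apply: (@le_trans _ _ (q%:R * eta)).
      have -> : (2 * T%:R)^-1 = N0%:R * eta.
        by rewrite /eta; field; rewrite !gt_eqF.
      by rewrite ler_pM2r// ler_nat dvdn_leq.
    apply: dist_int_id; apply/andP; split; first by rewrite mulr_ge0// ltW.
    apply: le_trans qeta _; rewrite invfM ler_piMr//.
    by rewrite invf_le1// ler1n.
  have h2 : c <= \prod_j dist_int (q%:R * ((b j)%:~R / (N j)%:R) - theta j).
    apply: ler_prod => j _; rewrite divr_ge0 ?dist_int_ge0//=.
    have [l' ql'] := dvdnP (dvdn_trans (NN0 j) dq).
    have -> : q%:R * ((b j)%:~R / (N j)%:R) - theta j
        = - theta j + (l'%:Z * b j)%:~R.
      by rewrite ql' intrM -pmulrn natrM; field; rewrite gt_eqF.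
    rewrite dist_intDz dist_intN; have := dist_int_ge0 (theta j); lra.
  have -> : 2^-1 * c = T%:R * ((2 * T%:R)^-1 * c).
    by move: (c) => z; field; rewrite gt_eqF.
  by rewrite ler_pM2l// ler_pM// invr_ge0 mulr_ge0// ltW.
(* The fraction a / N0 dominates the shift in the first factor. *)
have h1 : (2 * N0%:R)^-1 <= dist_int (q%:R * (a%:~R / N0%:R + eta)).
  have h3 := dist_int_frac_ge N0_gt0 co ndq.
  have := dist_int_lipschitz (q%:R * (a%:~R / N0%:R))
    (q%:R * (a%:~R / N0%:R + eta)).
  rewrite -mulrBr opprD addNKr mulrN normrN ger0_norm; last first.
    by rewrite mulr_ge0// ltW.
  move: qeta; rewrite invfM; lra.
(* Multiplying q zeta_j - theta_j by N_j removes the denominator of zeta_j. *)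
have h2 : c / (\prod_j N j)%:R <=
    \prod_j dist_int (q%:R * ((b j)%:~R / (N j)%:R) - theta j).
  rewrite natr_prod -prodf_div; apply: ler_prod => j _.
  rewrite !divr_ge0 ?dist_int_ge0//= ler_pdivrMr// [leRHS]mulrC.
  apply: le_trans (dist_intMn _ _).
  have -> : (N j)%:R * (q%:R * ((b j)%:~R / (N j)%:R) - theta j) =
     - ((N j)%:R * theta j) + (q%:Z * b j)%:~R.
    by rewrite intrM -pmulrn; field; rewrite gt_eqF.
  rewrite dist_intDz dist_intN; apply: le_trans (hN j).
  by rewrite ler_pdivrMr// mulVf// dist_int_le1.
have PR : (0 : R) < (\prod_j N j)%:R by rewrite ltr0n prodn_gt0.
have -> : 2^-1 * c = T%:R * ((2 * N0%:R)^-1 * (c / (\prod_j N j)%:R)).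
  rewrite /T natrM; move: (c) (_%:R) PR => z P PR.
  by field; rewrite !gt_eqF.
by rewrite ler_pM2l// ler_pM// ?invr_ge0 ?divr_ge0 ?mulr_ge0// ltW.
Qed.

End DistanceToNearestInteger.

(** * The open sets of points with large products *)

Section DenseOpen.
Variables (R : realType) (k : nat) (i0 : 'I_k) (theta : 'I_k.-1 -> R).

(** Each coordinate of y is rounded to a fraction whose denominator is a power of
    two at least 2^S; the numerator is odd for the coordinate of index i0, which is
    then shifted. *)
Lemma exists_near_point_large_product (y : 'rV[R]_k) (e : R) (M : nat) :
  (forall j, irrational (theta j)) -> 0 < e ->
  exists2 x : 'rV[R]_k, (forall i, `|y ord0 i - x ord0 i| < e) &
  exists2 T, (M <= T)%N & forall q, (0 < q <= T)%N ->
    2^-1 * \prod_j (dist_int (theta j) / 4) <=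
    T%:R * inhom_product i0 theta x q%:Z.
Proof.
move=> irt e0.
(* 2^S exceeds both M, to get M <= T, and 2 / e, to stay within e of y. *)
pose S := (M + Num.bound (2 / e))%N.
have S_small (N : nat) : (2 ^ S <= N)%N -> 2 / N%:R < e.
  move=> SN; have N_gt0 : (0 < N)%N by apply: leq_trans SN; rewrite expn_gt0.
  rewrite ltr_pdivrMr ?ltr0n// mulrC -ltr_pdivrMr//.
  apply: lt_le_trans (archi_boundP _) _; first by rewrite divr_ge0// ltW.
  rewrite ler_nat; apply: leq_trans SN; apply: leq_trans (ltnW (ltn_expl S _)) => //.
  exact: leq_addl.
have /choice[s hs] j : exists s,
    (S <= s)%N /\ 4^-1 <= dist_int ((2 ^ s)%:R * theta j).
  by have [s] := dist_int_pow2_large S (irt j); exists s.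
(* A sum rather than a maximum: s0 only has to bound S and all the s j. *)
pose s0 := (S + \sum_j s j)%N.
pose N0 := (2 ^ s0)%N; pose N j := (2 ^ s j)%N.
pose T := (N0 * \prod_j N j)%N.
have N0_gt0 : (0 < N0)%N by rewrite expn_gt0.
have N_gt0 j : (0 < N j)%N by rewrite expn_gt0.
have P_gt0 : (0 < \prod_j N j)%N by rewrite prodn_gt0.
have SN0 : (2 ^ S <= N0)%N by rewrite leq_exp2l// leq_addr.
have SN j : (2 ^ S <= N j)%N by rewrite leq_exp2l//; case: (hs j).
have MT : (M <= T)%N.
  apply: (@leq_trans N0); last exact: leq_pmulr.
  apply: leq_trans SN0; apply: leq_trans (ltnW (ltn_expl S _)) => //.
  exact: leq_addr.
have NN0 j : (N j %| N0)%N.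
  rewrite dvdn_exp2l// /s0 (bigD1 j)//= addnCA; exact: leq_addr.
have NR : (0 : R) < N0%:R by rewrite ltr0n.
have NjR j : (0 : R) < (N j)%:R by rewrite ltr0n.
have TR : (0 : R) < T%:R by rewrite ltr0n muln_gt0 N0_gt0.
(* 2 f + 1 is an odd integer within 1 of N0 times the coordinate of index i0. *)
pose f := Num.floor (y ord0 i0 * N0%:R / 2).
pose a : int := 2 * f + 1.
pose b j := Num.floor (y ord0 (lift i0 j) * (N j)%:R).
have co : coprimez N0 a.
  rewrite coprimezE [X in coprime X _]/= /N0 coprimeXl// coprime2n /a; lia.
pose xi : R := a%:~R / N0%:R + (2 * N0%:R * T%:R)^-1.
pose x : 'rV[R]_k := \row_i
  (if unlift i0 i is Some j then (b j)%:~R / (N j)%:R else xi).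
have x0 : x ord0 i0 = xi by rewrite mxE unlift_none.
have xj j : x ord0 (lift i0 j) = (b j)%:~R / (N j)%:R by rewrite mxE liftK.
exists x.
  move=> i; case: (unliftP i0 i) => [j ->|->].
    rewrite xj; apply: le_lt_trans (S_small _ (SN j)).
    have /andP[] := floor_itv (y ord0 (lift i0 j) * (N j)%:R).
    rewrite -/(b j) intrD => h1 h2.
    rewrite -[X in X - _](mulfK (lt0r_neq0 (NjR j))) -mulrBl normrM.
    rewrite [`|_^-1|]gtr0_norm ?invr_gt0// ler_pM2r ?invr_gt0//.
    by rewrite ger0_norm; lra.
  rewrite x0; apply: le_lt_trans (S_small _ SN0).
  have /andP[] := floor_itv (y ord0 i0 * N0%:R / 2).
  rewrite -/f intrD => h1 h2.
  have -> : y ord0 i0 - xi =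
      (y ord0 i0 * N0%:R - a%:~R - (2 * T%:R)^-1) / N0%:R.
    by rewrite /xi; field; rewrite !gt_eqF.
  rewrite normrM [`|_^-1|]gtr0_norm ?invr_gt0// ler_pM2r ?invr_gt0//.
  have T1 : (2 * T%:R)^-1 <= 1 :> R.
    have : (1 : R) <= T%:R by rewrite ler1n muln_gt0 N0_gt0.
    by move=> ?; rewrite invf_le1 ?mulr_gt0//; lra.
  have T0 : 0 <= (2 * T%:R)^-1 :> R by rewrite invr_ge0 mulr_ge0// ltW.
  by rewrite /a intrD intrM ler_norml; apply/andP; split; lra.
exists T => // q qT.
rewrite /inhom_product x0.
under [X in _ * (_ * X)]eq_bigr do rewrite xj.
by apply: product_lower_bound => // j; case: (hs j).
Qed.

Lemma dist_int_continuous : continuous (@dist_int R).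
Proof.
move=> x; apply/cvgrPdist_le => e e0; near=> y.
have xy : `|x - y| <= e by near: y; apply: cvgr_dist_le.
rewrite ler_norml; apply/andP; split.
  have := dist_int_lipschitz y x; rewrite distrC; lra.
have := dist_int_lipschitz x y; lra.
Unshelve. all: by end_near. Qed.

Lemma inhom_product_continuous (q : int) :
  continuous (fun x : 'rV[R]_k => inhom_product i0 theta x q).
Proof.
have coord i (t : R) :
    continuous (fun x : 'rV[R]_k => dist_int (q%:~R * x ord0 i - t)).
  have dist_cont : continuous (fun z : R => dist_int (q%:~R * z - t)).
    move=> z; apply: (@continuous_comp _ _ _ (fun z : R => q%:~R * z - t)
      (@dist_int R)); last exact: dist_int_continuous.
    by apply: cvgB; [apply: cvgM; [exact: cvg_cst|exact: cvg_id]|exact: cvg_cst].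
  move=> x; apply: (@continuous_comp _ _ _ (fun M : 'rV[R]_k => M ord0 i)
    (fun z => dist_int (q%:~R * z - t))).
    exact: coord_continuous.
  exact: dist_cont.
pose f j (x : 'rV[R]_k) := dist_int (q%:~R * x ord0 (lift i0 j) - theta j).
have prodc (r : seq 'I_k.-1) : continuous (fun x => \prod_(j <- r) f j x).
  elim: r => [|j r IH] x.
    rewrite (_ : (fun x => _) = cst 1); first exact: cst_continuous.
    by apply/funext => z; rewrite big_nil.
  rewrite (_ : (fun x => _) = (f j \* (fun x => \prod_(j <- r) f j x))).
    by apply: continuousM; [exact: coord|exact: IH].
  by apply/funext => z; rewrite big_cons.
move=> x; apply: (@continuousM _ _
  (fun x : 'rV[R]_k => dist_int (q%:~R * x ord0 i0))).
  rewrite (_ : (fun x => _) =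
      (fun x : 'rV[R]_k => dist_int (q%:~R * x ord0 i0 - 0))).
    exact: coord.
  by apply/funext => z; rewrite subr0.
exact: prodc.
Qed.

Definition large_product_set (c : R) (T : nat) : set 'rV[R]_k :=
  [set x | forall q, (0 < q <= T)%N -> c < T%:R * inhom_product i0 theta x q%:Z].

Lemma open_large_product_set c T : open (large_product_set c T).
Proof.
have open1 (q : nat) :
    open [set x | c < T%:R * inhom_product i0 theta x q%:Z].
  apply: (@open_comp _ _ (fun x => T%:R * inhom_product i0 theta x q%:Z)
    [set z | c < z]); last exact: open_gt.
  move=> x _; apply: (@continuousM _ _ (fun=> T%:R)
    (fun x => inhom_product i0 theta x q%:Z)); first exact: cst_continuous.
  exact: inhom_product_continuous.
rewrite openE => x cx; rewrite /interior/=.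
have near_x (i : 'I_T) :
    \forall z \near x, c < T%:R * inhom_product i0 theta z i.+1%:Z.
  by apply: open_nbhs_nbhs; split; [exact: open1|apply: cx => /=; exact: ltn_ord].
apply: filterS (@filter_forall _ _ _ _ _ near_x) => z cz [//|q] qT.
exact: (cz (Ordinal qT)).
Qed.

Lemma scaled_min_ge c T x : (0 < T)%N ->
  large_product_set c T x -> (c%:E <= scaled_min i0 theta x T)%E.
Proof.
move=> T0 h; have TR : (0 : R) < T%:R by rewrite ltr0n.
rewrite /scaled_min muleC -lee_pdivrMr// -EFinM.
rewrite big_nat_cond; 
apply: (big_ind (fun z => ((c / T%:R)%:E <= z)%E)) => [|u v|q]; first exact: leey.
  by rewrite le_min => -> ->.
rewrite andbT ltnS => qT; rewrite lee_fin ler_pdivrMr// mulrC ltW//.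
exact: h.
Qed.

Lemma limn_esup_ge (u : (\bar R)^nat) (c : \bar R) :
  (forall M, exists2 T, (M <= T)%N & (c <= u T)%E) -> (c <= limn_esup u)%E.
Proof.
move=> h; apply: le_ereal_inf_tmp => _ [A [M _ MA] <-].
have [T MT cT] := h M; apply: le_trans cT _.
by apply: ereal_sup_ubound; exists T => //; apply: MA.
Qed.

End DenseOpen.

(** * The dense G-delta set *)

(** Real matrices are both complete and normed; this joins the two structures,
    so that Baire's theorem applies to row vectors. *)
HB.instance Definition _ (R : realType) m n := Complete.on 'M[R]_(m, n).

Theorem theorem3p1 (R : realType) (k : nat) (hk : (2 <= k)%N)
    (theta : 'I_k.-1 -> R)
    (htheta : forall j : 'I_k.-1, irrational (theta j))
    (hsys : exists gamma1 gamma2 : R,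
      [/\ 0 < gamma1, gamma1 < gamma2 &
        infinite_set [set q : int |
          gamma1 * q%:~R ^- k.-1
            < \big[Num.max/0]_(j < k.-1) dist_int (q%:~R * theta j)
            < gamma2 * q%:~R ^- k.-1]]) :
  exists2 G : set 'rV[R]_k,
    Gdelta G /\ dense G &
    G `<=` [set x : 'rV[R]_k |
      (0 < limn_esup (scaled_min (Ordinal (ltnW hk)) theta x))%E].
Proof.
set i0 := Ordinal _.
pose c := 2^-1 * \prod_j (dist_int (theta j) / 4).
have c_gt0 : 0 < c.
  by rewrite mulr_gt0// prodr_gt0// => j _; rewrite divr_gt0// dist_int_gt0.
(* Open sets need a strict inequality, hence a constant below c. *)
pose F M := \bigcup_(T in [set T | (M < T)%N]) large_product_set i0 theta (c / 2) T.
have F_open M : open (F M).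
  by apply: bigcup_open => T _; exact: open_large_product_set.
have F_dense M : dense (F M).
  move=> O [y Oy] oO.
  have /nbhs_ballP[e/= e0 yeO] : nbhs y O by exact: open_nbhs_nbhs.
  have [x xy [T MT hT]] := exists_near_point_large_product i0 y M.+1 htheta e0.
  exists x; split.
    by apply: yeO; split => // i j; rewrite ord1; exact: xy.
  exists T => // q qT; apply: lt_le_trans (hT q qT).
  by rewrite ltr_pdivrMr// ltr_pMr// ltr1n.
exists (\bigcap_M F M); first by split; [exists F|apply: Baire].
move=> x Fx; apply: (@lt_le_trans _ _ (c / 2)%:E).
  by rewrite lte_fin divr_gt0.
apply: limn_esup_ge => M; have [T MT hT] := Fx M I.
exists T; first exact: ltnW.
by apply: scaled_min_ge => //; apply: leq_trans MT.
Qed.
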